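(* The word $$w=aabaababaabaabababaabaababab$$ over $\{a<b\}$ is a Lyndon word of length $28$ that contains exactly $10$ distinct Lyndon factors; $10$ is the minimum number of distinct Lyndon factors over all Lyndon words of length $28$ (over finite totally ordered alphabets); and $w$ is not a Christoffel word. Consequently, the following assertion is false: ''if $n\neq 6$ and $w$ is a Lyndon word of length $n$ containing the least number of distinct Lyndon factors over all Lyndon words of the same length, then $w$ is a Christoffel word.''
   Context: Words over a finite totally ordered alphabet are compared by the induced lexicographic order. A word $z$ is a factor of $w$ if $w=uzv$ for some (possibly empty) words $u,v$ (so $w$ is a factor of itself). A word is primitive if it is non-empty and is not a power $x^k$, $k\ge 2$, of a shorter word. Two words $u,v$ are conjugate if $u=xy$, $v=yx$ for some words $x,y$. A Lyndon word is a non-empty primitive word that is lexicographically least in its conjugacy class (equivalently, a non-empty word that is a single letter or is strictly smaller than each of its non-empty proper suffixes). The number of distinct Lyndon factors of a word counts each Lyndon word occurring as a factor once. An infinite word $\boldsymbol{s}$ over $\{a,b\}$ is Sturmian if there exist an irrational $\alpha\in(0,1)$ and a real $\rho$ such that either for all $n\ge 0$: $\boldsymbol{s}[n]=a$ if $\lfloor (n+1)\alpha+\rho\rfloor-\lfloor n\alpha+\rho\rfloor=0$ and $\boldsymbol{s}[n]=b$ otherwise; or for all $n\ge 0$: $\boldsymbol{s}[n]=a$ if $\lceil (n+1)\alpha+\rho\rceil-\lceil n\alpha+\rho\rceil=0$ and $\boldsymbol{s}[n]=b$ otherwise. A Christoffel word here means a Lyndon word that is a factor of an infinite Sturmian word.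 *)

(* Defs.v *)
From HB Require Import structures.
From mathcomp Require Import all_boot all_order all_algebra finmap.
From mathcomp Require Import boolp classical_sets cardinality reals.

Set Implicit Arguments.
Unset Strict Implicit.
Unset Printing Implicit Defensive.

Import Order.TTheory GRing.Theory Num.Theory.

Local Open Scope classical_set_scope.

(* Words over a finite totally ordered alphabet T are sequences over T;
   [seqlexi T] is [seq T] with its lexicographic (dictionary) order, in which a
   proper prefix is smaller.  "z is a factor of w" is [infix z w]. *)
Section Words.
Context {d : Order.disp_t} {T : finOrderType d}.
Implicit Types u v w z : seq T.

Definition word_pow (x : seq T) (k : nat) : seq T := flatten (nseq k x).

Definition primitive w : Prop :=
  w <> [::] /\
  ~ exists (x : seq T) (k : nat),
      [/\ 2 <= k, size x < size w & w = word_pow x k].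

Definition conjugate u v : Prop :=
  exists x y : seq T, u = x ++ y /\ v = y ++ x.

Definition lyndon w : Prop :=
  primitive w /\
  forall v, conjugate w v -> ((w : seqlexi T) <= (v : seqlexi T))%O.

Definition lyndon_factors w : set (seq T) :=
  [set z | infix z w /\ lyndon z].

(* [fset_set] is only meaningful on finite sets. *)
Lemma finite_lyndon_factors w : finite_set (lyndon_factors w).
Proof.
pose s := [seq take i (drop j w) | i <- iota 0 (size w).+1,
                                   j <- iota 0 (size w).+1].
apply: (@sub_finite_set _ _ [set` s]); last exact: finite_seq.
move=> z [/infixP [p [q wE]] _] /=.
rewrite {}/s wE; apply/allpairsP; exists (size z, size p).
split; last by rewrite /= drop_size_cat // take_size_cat.
  by rewrite mem_iota /= add0n ltnS !size_cat addnCA leq_addr.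
by rewrite mem_iota /= add0n ltnS size_cat leq_addr.
Qed.

Definition num_lyndon_factors w : nat := #|` fset_set (lyndon_factors w)|.

End Words.

(* The alphabet {a < b} is [bool], with a := false and b := true
   (so that false < true). *)
Section Christoffel.
Variable R : realType.
Local Open Scope ring_scope.

Definition lower_mechanical (alpha rho : R) (n : nat) : bool :=
  if Num.floor (n.+1%:R * alpha + rho) - Num.floor (n%:R * alpha + rho) == 0
  then false else true.

Definition upper_mechanical (alpha rho : R) (n : nat) : bool :=
  if Num.ceil (n.+1%:R * alpha + rho) - Num.ceil (n%:R * alpha + rho) == 0
  then false else true.

Definition sturmian (s : nat -> bool) : Prop :=
  exists alpha rho : R,
    [/\ 0 < alpha < 1, irrational alpha &
        (forall n, s n = lower_mechanical alpha rho n) \/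
        (forall n, s n = upper_mechanical alpha rho n)].

Definition factor_infinite (z : seq bool) (s : nat -> bool) : Prop :=
  exists i : nat, z = [seq s (i + k)%N | k <- iota 0 (size z)].

Definition christoffel (w : seq bool) : Prop :=
  lyndon w /\ exists s : nat -> bool, sturmian s /\ factor_infinite w s.

End Christoffel.

Definition word28 : seq bool :=
  let a := false in let b := true in
  [:: a; a; b; a; a; b; a; b; a; a; b; a; a; b; a; b; a; b; a; a; b; a; a; b;
      a; b; a; b].

(* Main.v *)
Require Import Defs.
From HB Require Import structures.
From mathcomp Require Import all_boot all_order all_algebra finmap.
From mathcomp Require Import boolp classical_sets cardinality reals.
From mathcomp Require Import lra.

Set Implicit Arguments.
Unset Strict Implicit.
Unset Printing Implicit Defensive.

Import Order.TTheory GRing.Theory Num.Theory.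

(** Only the minimality of 10 needs an idea; the rest is evaluation and one
    balance argument.

    A word is Lyndon if and only if it is non-empty and strictly smaller than
    its proper non-empty suffixes ([lyndonE]).  This test is decidable, so the
    Lyndon factors of a word can be listed, and the facts about [word28] itself
    follow by evaluating the list ([num_lyndon_factorsE]).

    For the lower bound, suppose that a Lyndon word of length 28 has at most 9
    Lyndon factors.  Both properties depend only on the relative order of its
    letters, so these may be renamed 0, ..., m-1, all of them occurring
    ([rank_letters]).  Each letter is a Lyndon factor, so m <= 9.  The word is
    now built letter by letter from its first letter, which is 0.  Two
    conditions cut a prefix q off: some suffix of q is smaller than q at the
    first place where they differ (no Lyndon word starts with such a q,
    [lyndon_prefix_not_above]); or q already contains too many Lyndon factors.
    Lyndon factors accumulate so fast that only some ten thousand prefixes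
    survive, and none of them reaches a Lyndon word of length 28
    ([no_extension_sound], [search28]).

    A Sturmian word of slope alpha has, in each window of length k, a number of
    b's at distance less than 1 from k * alpha, so two windows of equal length
    differ by at most one b ([sturmian_balanced]).  But [word28] contains aabaa
    and babab, which have one and three b's. *)

(** * Deciding the Lyndon property *)

Section Decision.
Context {T : eqType}.
Implicit Types (lt : rel T) (P : pred (seq T)) (s t u v w x y z : seq T).

(** Nested [if] rather than boolean connectives, here and in the search below:
    call-by-value evaluation computes both arguments of [andb] and [orb]. *)
Fixpoint lexlt lt s t : bool :=
  match s, t with
  | _, [::] => false
  | [::], _ :: _ => true
  | a :: s', b :: t' =>
      if lt a b then true else if lt b a then false else lexlt lt s' t'
  end.

(** Suffixes are non-empty here. *)
Fixpoint all_suffixes P s : bool :=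
  if s is _ :: s' then if P s then all_suffixes P s' else false else true.

Definition lyndonb lt w : bool :=
  if w is _ :: w' then all_suffixes (lexlt lt w) w' else false.

Definition factors w : seq (seq T) :=
  [seq take i (drop j w) | i <- iota 0 (size w).+1, j <- iota 0 (size w).+1].

Definition lyndon_list lt w : seq (seq T) :=
  undup [seq z <- factors w | lyndonb lt z].

Lemma all_suffixesP P s :
  reflect (forall x y, s = x ++ y -> y != [::] -> P y) (all_suffixes P s).
Proof.
apply: (iffP idP).
  elim: s => [|a s IHs] /=; first by move=> _ [|? ?] [|? ?].
  by case: ifP => // Pas /IHs sP [|b x] y /= => [<-//|[_ /sP]].
elim: s => //= a s IHs sP; rewrite (sP [::]) //.
by apply: IHs => x y sE; apply: (sP (a :: x)); rewrite sE.
Qed.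

Lemma lyndonbP lt w :
  reflect (w != [::] /\
           forall x y, w = x ++ y -> x != [::] -> y != [::] -> lexlt lt w y)
          (lyndonb lt w).
Proof.
case: w => [|a w]; first by constructor; case.
apply: (iffP (all_suffixesP _ _)) => [wP|[_ wP] x y wE].
  by split=> // - [|b x] y // [_ wE] _; apply: wP wE.
by apply: (wP (a :: x)); rewrite ?wE.
Qed.

Lemma mem_factors z w : (z \in factors w) = infix z w.
Proof.
apply/allpairsP/infixP => [[[i j] /= [_ _ ->]]|[p [q wE]]].
  exists (take j w), (drop i (drop j w)).
  by rewrite cat_take_drop cat_take_drop.
exists (size z, size p); rewrite wE !mem_iota /= !add0n !ltnS !size_cat.
rewrite leq_addr (addnCA (size p)) leq_addr; split=> //.
by rewrite drop_size_cat // take_size_cat.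
Qed.

Lemma mem_lyndon_list lt z w :
  (z \in lyndon_list lt w) = infix z w && lyndonb lt z.
Proof. by rewrite mem_undup mem_filter mem_factors andbC. Qed.

End Decision.

(** * Minimal conjugates and minimal suffixes *)

Section Bridge.
Context {d : Order.disp_t} {T : finOrderType d}.
Implicit Types (s t u v w x y z : seq T).
Local Notation lt := (<%O : rel T).

Lemma lexltE s t : lexlt lt s t = ((s : seqlexi T) < (t : seqlexi T))%O.
Proof.
elim: s t => [|a s IHs] [|b t] //=.
by rewrite ltxi_cons IHs; case: ltgtP.
Qed.

Lemma lexlt_cat2l z s t : lexlt lt (z ++ s) (z ++ t) = lexlt lt s t.
Proof. by elim: z => //= a z IHz; rewrite ltxx. Qed.

(** If [s < t] and [s] is not a prefix of [t], then the words differ at a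
    position that both have, and what is appended does not matter. *)
Lemma lexlt_cat s t u v :
  ~~ prefix s t -> lexlt lt s t -> lexlt lt (s ++ u) (t ++ v).
Proof.
elim: s t => [|a s IHs] [|b t] //=; rewrite negb_and.
by case: ltgtP => //= _; apply: IHs.
Qed.

Lemma prefix_leq_size_eq s t : size t <= size s -> prefix s t -> s = t.
Proof.
move=> le_ts; rewrite prefixE => /eqP <-.
by rewrite take_oversize.
Qed.

(** Euclid's algorithm on the lengths: the shorter of two commuting words is a
    prefix of the longer one, and commutes with what remains of it. *)
Lemma commuting_powers x y : x ++ y = y ++ x ->
  exists z i j, x = word_pow z i /\ y = word_pow z j.
Proof.
have [n] := ubnP (size x + size y).
elim: n x y => // n IHn x y.
wlog le_xy : x y / size x <= size y => [wl|] lt_n xy.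
  have [/wl|/ltnW/wl] := leqP (size x) (size y); first exact.
  rewrite addnC => /(_ lt_n (esym xy)) [z [i [j [-> ->]]]].
  by exists z, j, i.
case: x => [|a x] in le_xy lt_n xy *.
  by exists y, 0, 1; rewrite /word_pow /= cats0.
have yE : y = (a :: x) ++ drop (size (a :: x)) y.
  have /(congr1 (take (size (a :: x)))) := xy.
  rewrite take_size_cat // takel_cat // => xE.
  by rewrite {1}xE cat_take_drop.
move: (drop _ _) yE => y' yE; subst y.
have {}xy : (a :: x) ++ y' = y' ++ a :: x.
  by apply/eqP; move/eqP: xy; rewrite -catA eqseq_cat // eqxx.
have [|z [i [j [xE y'E]]]] := IHn (a :: x) y' _ xy.
  rewrite size_cat ltnS in lt_n; apply: leq_trans lt_n.
  by rewrite ltn_add2l /= addSn ltnS leq_addl.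
exists z, i, (i + j); split=> //.
by rewrite {1}xE {1}y'E /word_pow nseqD flatten_cat.
Qed.

Lemma primitive_neq_conjugate x y :
  primitive (x ++ y) -> x != [::] -> y != [::] -> x ++ y != y ++ x.
Proof.
move=> [_ prim] x0 y0; apply/eqP => /commuting_powers [z [i [j [xE yE]]]].
have nz0 n : word_pow z n != [::] -> 0 < n /\ 0 < size z.
  by case: n => //; case: (z) => // n; rewrite /word_pow; elim: n.
have [i0 z0] : 0 < i /\ 0 < size z by apply: nz0; rewrite -xE.
have [j0 _] : 0 < j /\ 0 < size z by apply: nz0; rewrite -yE.
have size_pow n : size (word_pow z n) = n * size z.
  by elim: n => //= n IHn; rewrite size_cat IHn mulSn.
apply: prim; exists z, (i + j); rewrite xE yE; split.
- by rewrite -addn1 leq_add.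
- by rewrite size_cat !size_pow -mulnDl ltn_Pmull // -addn1 leq_add.
- by rewrite /word_pow nseqD flatten_cat.
Qed.

(** Let [w = x ++ y].  If [w] is Lyndon, then [w < y ++ x]; were [y < w], this
    would be contradicted unless [y] is a prefix of [w], and if [w = y ++ z]
    then cancelling [y] gives [z < x], so that the conjugate [z ++ y] would be
    smaller than [w].  Conversely, [w < y] is decided inside [y] because [y] is
    shorter, hence [w < y ++ x]; and a proper power has a suffix that is also a
    prefix, which cannot be larger than the power. *)
Lemma lyndonE w : lyndon w <-> lyndonb lt w.
Proof.
split=> [[prim wmin]|/lyndonbP [w0 wP]].
  apply/lyndonbP; split=> [|x y wE x0 y0]; first by apply/eqP; case: prim.
  have lt_sz : size y < size w.
    by rewrite wE size_cat -[X in X < _]add0n ltn_add2r lt0n size_eq0.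
  have lt_wyx : lexlt lt w (y ++ x).
    rewrite lexltE lt_neqAle wmin; last by exists x, y.
    by rewrite wE andbT primitive_neq_conjugate -?wE.
  rewrite lexltE ltNge le_eqVlt; apply/negP => /predU1P [yw|].
    by rewrite yw ltnn in lt_sz.
  rewrite -lexltE => lt_yw.
  have [/prefixP [z wE']|npre] := boolP (prefix y w); last first.
    have := lexlt_cat x [::] npre lt_yw; rewrite cats0 lexltE => /lt_trans.
    by move: lt_wyx; rewrite lexltE => lt1 /(_ _ lt1); rewrite ltxx.
  have lt_zx : lexlt lt z x by move: lt_wyx; rewrite wE' lexlt_cat2l.
  have sz_zx : size x = size z.
    have := congr1 size wE'; rewrite wE !size_cat addnC.
    by move/eqP; rewrite eqn_add2l => /eqP.
  have npre : ~~ prefix z x.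
    apply/negP => /prefix_leq_size_eq zx; move: lt_zx.
    by rewrite zx ?sz_zx // lexltE ltxx.
  have := lexlt_cat y y npre lt_zx; rewrite lexltE -wE ltNge wmin //.
  by exists y, z.
split; last first.
  move=> v [x [y [wE ->]]].
  have [x0|x0] := eqVneq x [::]; first by rewrite wE x0 cats0.
  have [y0|y0] := eqVneq y [::]; first by rewrite wE y0 cats0.
  have lt_wy := wP x y wE x0 y0.
  have npre : ~~ prefix w y.
    apply/negP => /size_prefix.
    by rewrite wE size_cat leqNgt -[X in X < _]add0n ltn_add2r lt0n size_eq0 x0.
  have := lexlt_cat [::] x npre lt_wy.
  by rewrite cats0 lexltE => /ltW.
split=> [|[x [k [k2 szx wE]]]]; first exact/eqP.
case: k k2 wE => [|[|k]] // _ wE.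
have x0 : x != [::].
  apply: contra w0 => /eqP x0; rewrite wE x0 /word_pow.
  by elim: (k.+2).
have wE2 : w = word_pow x k.+1 ++ x.
  by rewrite wE /word_pow -addn1 nseqD flatten_cat /= cats0.
have pow0 : word_pow x k.+1 != [::] by case: (x) x0.
have := wP _ _ wE2 pow0 x0.
rewrite wE -[X in lexlt _ _ X]cats0 [word_pow _ _]/= lexlt_cat2l.
by case: (_ ++ _).
Qed.

Lemma num_lyndon_factorsE w : num_lyndon_factors w = size (lyndon_list lt w).
Proof.
rewrite /num_lyndon_factors.
have -> : fset_set (lyndon_factors w) = [fset z in lyndon_list lt w]%fset.
  apply/fsetP => z; rewrite in_fset_set ?inE; last exact: finite_lyndon_factors.
  rewrite /= mem_lyndon_list.
  by apply/asboolP/andP => [[zw /lyndonE]|[zw /lyndonE]].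
by rewrite card_fseq undup_id ?undup_uniq.
Qed.

End Bridge.

(** * Renaming the letters by their ranks *)

Section Renaming.
Context {T U : eqType} {ltT : rel T} {ltU : rel U} {f : T -> U}.
Context {A : {pred T}}.
Hypothesis f_mono : {in A &, {mono f : a b / ltT a b >-> ltU a b}}.
Implicit Types (s t w : seq T).

Lemma lexlt_map s t :
  {subset s <= A} -> {subset t <= A} ->
  lexlt ltU (map f s) (map f t) = lexlt ltT s t.
Proof.
elim: s t => [|a s IHs] [|b t] //= sA tA.
have [aA bA] : a \in A /\ b \in A by rewrite sA ?tA ?mem_head.
rewrite !f_mono // IHs // => c cin; [apply: sA | apply: tA].
  by rewrite inE cin orbT.
by rewrite inE cin orbT.
Qed.

Lemma lyndonb_map w : {subset w <= A} -> lyndonb ltU (map f w) = lyndonb ltT w.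
Proof.
have suf v : {subset w <= A} -> {subset v <= A} ->
  all_suffixes (lexlt ltU (map f w)) (map f v) =
  all_suffixes (lexlt ltT w) v.
  move=> wA; elim: v => // b v IHv vA; rewrite [LHS]/= -map_cons.
  by rewrite lexlt_map // IHv // => c cv; apply: vA; rewrite inE cv orbT.
case: w suf => // a w suf wA; apply: suf => // c cw.
by apply: wA; rewrite inE cw orbT.
Qed.

(** Every factor of [map f w] is the image of a factor of [w]. *)
Lemma lyndon_list_map w : {subset w <= A} ->
  size (lyndon_list ltU (map f w)) <= size (lyndon_list ltT w).
Proof.
move=> wA; rewrite -(size_map (map f)); apply: uniq_leq_size.
  exact: undup_uniq.
move=> z; rewrite mem_lyndon_list => /andP[/infixP[p [q wE]] zL].
have /eqP := wE; rewrite -{1}(cat_take_drop (size p) w) map_cat.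
have le_pw : size p <= size w by rewrite -(size_map f w) wE size_cat leq_addr.
rewrite eqseq_cat ?size_map ?size_takel // => /andP[_ /eqP].
set w1 := drop _ w => w1E.
have := w1E; rewrite -{1}(cat_take_drop (size z) w1) map_cat => /eqP.
have le_zw : size z <= size w1.
  by rewrite -(size_map f w1) w1E size_cat leq_addr.
rewrite eqseq_cat ?size_map ?size_takel // => /andP[/eqP zE _].
have inf : infix (take (size z) w1) w.
  apply/infixP; exists (take (size p) w), (drop (size z) w1).
  by rewrite cat_take_drop cat_take_drop.
apply/mapP; exists (take (size z) w1); last by [].
rewrite mem_lyndon_list inf -lyndonb_map ?zE // => c cin.
by apply/wA/(mem_infix inf).
Qed.

End Renaming.

Section Ranks.
Context {d : Order.disp_t} {T : finOrderType d}.

Lemma rank_letters (u : seq T) :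
  exists (p : seq nat) m,
    [/\ size p = size u, p =i iota 0 m,
        lyndonb ltn p = lyndonb <%O u &
        size (lyndon_list ltn p) <= size (lyndon_list <%O u)].
Proof.
pose s := sort <=%O (undup u).
have s_u : s =i u by move=> a; rewrite mem_sort mem_undup.
have s_sorted : sorted <%O s by rewrite sort_lt_sorted undup_uniq.
have mono : {in u &, {mono index^~ s : a b / (a < b)%O >-> a < b}}.
  move=> a b; rewrite -!s_u => sa sb /=.
  by rewrite -(lt_sorted_ltn_nth a s_sorted) ?inE ?index_mem // !nth_index.
exists (map (index^~ s) u), (size s); split.
- by rewrite size_map.
- move=> i; rewrite mem_iota /= add0n; apply/mapP/idP => [[a ua ->]|lt_is].
    by rewrite index_mem s_u.
  have [a|] := boolP (nilp s); first by move: lt_is; rewrite (nilP a).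
  case: (s) lt_is s_u (lt_sorted_uniq s_sorted) => // a s' lt_is s_u uniq_s _.
  by exists (nth a (a :: s') i); rewrite ?index_uniq // -s_u mem_nth.
- exact: (lyndonb_map mono).
- exact: (lyndon_list_map mono).
Qed.

End Ranks.

(** * Exhaustive search on prefixes *)

Section Search.
Implicit Types (m B k : nat) (L : seq (seq nat)) (p q s t w z : seq nat).

(** [s <= t] after truncation to the common length: unlike [lexlt], this is
    preserved when both words are cut, so it passes from a word to its
    prefixes. *)
Fixpoint not_above s t : bool :=
  match s, t with
  | a :: s', b :: t' =>
      if a < b then true else if b < a then false else not_above s' t'
  | _, _ => true
  end.

Fixpoint add_lyndon_suffixes L s : seq (seq nat) :=
  if s is _ :: s' then
    let L' := add_lyndon_suffixes L s' in
    if lyndonb ltn s then if s \in L' then L' else s :: L' else L'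
  else L.

(** No word with at most [B] Lyndon factors, and with the letters below [m], is
    Lyndon and extends [p] by [k] letters.  The list [L] holds distinct Lyndon
    words that are known to be factors; as long as the word is not complete
    ([0 < k']), the completed word is itself one more Lyndon factor. *)
Fixpoint no_extension m B k p L : bool :=
  if k is k'.+1 then
    all (fun c =>
           let q := rcons p c in
           if all_suffixes (not_above q) q then
             let L' := add_lyndon_suffixes L q in
             if B < (0 < k') + size L' then true
             else no_extension m B k' q L'
           else true)
        (iota 0 m)
  else ~~ lyndonb ltn p.

Lemma not_above_refl s : not_above s s.
Proof. by elim: s => //= a s; rewrite ltnn. Qed.

Lemma lexlt_not_above s s' t t' :
  lexlt ltn (s ++ s') (t ++ t') -> not_above s t.
Proof.
elim: s t => [|a s IHs] [|b t] //=.
by case: ifP => // _; case: ifP => // _; apply: IHs.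
Qed.

Lemma lyndon_prefix_not_above q r :
  lyndonb ltn (q ++ r) -> all_suffixes (not_above q) q.
Proof.
move=> /lyndonbP[_ wP]; apply/all_suffixesP => x y qE y0.
have [x0|x0] := eqVneq x [::]; first by rewrite qE x0 not_above_refl.
apply: (@lexlt_not_above _ r _ r); apply: (wP x) => //.
  by rewrite qE catA.
by case: (y) y0.
Qed.

Lemma add_lyndon_suffixes_uniq L s : uniq L -> uniq (add_lyndon_suffixes L s).
Proof.
move=> uL; elim: s => //= a s IHs.
by case: ifP => // _; case: ifP => //= ->.
Qed.

Lemma mem_add_lyndon_suffixes L s z :
  z \in add_lyndon_suffixes L s ->
  z \in L \/ lyndonb ltn z /\ exists x, s = x ++ z.
Proof.
elim: s => [|a s IHs] /=; first by left.
have step : z \in add_lyndon_suffixes L s ->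
    z \in L \/ lyndonb ltn z /\ exists x, a :: s = x ++ z.
  by case/IHs => [|[zL [x ->]]]; [left | right; split=> //; exists (a :: x)].
case: ifP => // asL; case: ifP => // _; rewrite inE => /predU1P[->|//].
by right; split=> //; exists [::].
Qed.

Lemma no_extension_sound m B k p L w :
  no_extension m B k p L -> size p + k = size w -> prefix p w ->
  {in w, forall a, a < m} -> lyndonb ltn w -> uniq L ->
  {in L, forall z, z \in lyndon_list ltn w /\ size z <= size p} ->
  B < size (lyndon_list ltn w).
Proof.
elim: k p L => [|k IHk] p L /=.
  move=> nlyn sz /prefixP[[|c r]] wE; last first.
    move: sz; rewrite wE size_cat /= addn0 => /eqP.
    by rewrite -[X in X == _]addn0 eqn_add2l.
  by move: nlyn; rewrite wE cats0 => /negP.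
move=> ext sz /prefixP[[|c r] wE].
  by move: sz; rewrite wE cats0 addnS => /eqP; rewrite gtn_eqF // ltnS leq_addr.
move=> w_lt wlyn uL LP; set q := rcons p c.
have wE' : w = q ++ r by rewrite cat_rcons.
have cm : c \in iota 0 m.
  by rewrite mem_iota w_lt // wE' mem_cat mem_rcons mem_head.
have := allP ext c cm; rewrite -/q wE' in wlyn *.
rewrite (lyndon_prefix_not_above wlyn); rewrite -wE' in wlyn *.
set L' := add_lyndon_suffixes L q => /=.
have szq : size q = (size p).+1 by rewrite size_rcons.
have uL' : uniq L' by apply: add_lyndon_suffixes_uniq.
have LP' : {in L', forall z, z \in lyndon_list ltn w /\ size z <= size q}.
  move=> z /mem_add_lyndon_suffixes[/LP[zL le_zp]|[zlyn [x qE]]].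
    by rewrite szq; split=> //; apply: leqW.
  rewrite mem_lyndon_list zlyn andbT qE size_cat leq_addl; split=> //.
  by apply/infixP; exists x, r; rewrite wE' qE catA.
have szqk : size q + k = size w by rewrite szq addSnnS.
case: ifP => [lt_B _|_ ext']; last first.
  by apply: IHk ext' szqk _ w_lt wlyn uL' LP'; rewrite wE' prefix_prefix.
apply: leq_trans lt_B _.
(* For an incomplete prefix, [w] is longer than every element of [L'], which
   gives one more Lyndon factor. *)
case: k szqk {IHk ext sz} => [|k] szqk.
  by apply: uniq_leq_size => // z /LP'[].
apply: (@uniq_leq_size _ (w :: L')) => /= [|z].
  rewrite uL' andbT; apply/negP => /LP'[_].
  by rewrite -szqk addnS leqNgt ltnS leq_addr.
rewrite inE => /predU1P[->|/LP'[] //].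
by rewrite mem_lyndon_list infix_refl.
Qed.

(** If [m > B], the letters alone are more than [B] Lyndon factors.  Otherwise
    the search applies; it may start from [0], because a suffix of [w] that
    starts with [0] is not smaller than [w], so that [w] starts with [0] too. *)
Lemma lyndon_list_lower_bound B n :
  0 < n ->
  all (fun m => no_extension m B n [:: 0] [seq [:: i] | i <- iota 0 m])
      (iota 1 B) ->
  forall m w, size w = n.+1 -> w =i iota 0 m -> lyndonb ltn w ->
  B < size (lyndon_list ltn w).
Proof.
move=> n0 ext m w sz w_m wlyn.
have letter_in : {in [seq [:: i] | i <- iota 0 m], forall z,
    z \in lyndon_list ltn w /\ size z <= size [:: 0]}.
  move=> z /mapP[i im ->]; rewrite -w_m in im.
  rewrite mem_lyndon_list andbT /=; split=> //.
  by case/path.splitPr: im => x y; apply/infixP; exists x, y.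
have uniq_letters : uniq [seq [:: i] | i <- iota 0 m].
  by rewrite map_inj_uniq ?iota_uniq // => i j [].
have [le_mB|lt_Bm] := leqP m B; last first.
  apply: leq_trans lt_Bm _.
  rewrite -[X in X <= _](size_iota 0) -(size_map (fun i => [:: i])).
  by apply: uniq_leq_size => // z /letter_in[].
case: w => [|a w] // in sz w_m wlyn letter_in *.
have m0 : 0 < m.
  by have := w_m a; rewrite mem_head mem_iota; case: (m).
apply: (no_extension_sound (m := m) (k := n) (p := [:: 0])
          (L := [seq [:: i] | i <- iota 0 m])) => //.
- by apply: (allP ext); rewrite mem_iota m0 add1n ltnS.
- suff -> : a = 0 by rewrite /= prefix0s.
  have : 0 \in a :: w by rewrite w_m mem_iota.
  rewrite inE => /predU1P[//|w0].
  case/path.splitPr: w0 wlyn => x y /lyndonbP[_].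
  by move=> /(_ (a :: x) (0 :: y) erefl isT isT) /=; case: (a).
- by move=> b; rewrite w_m mem_iota.
Qed.

End Search.

(** * Balance of Sturmian words *)

Section Balance.
Context {R : realType}.
Implicit Types (s : nat -> bool) (alpha rho : R).
Local Open Scope ring_scope.

(** Stated for any [F] so as to cover the floor and the ceiling of
    [n * alpha + rho] at once.  The increments of [F] are 0 or 1, being less
    than 1 away from [alpha]; hence they are the letters of [s], and the number
    of ones in a window is a telescoping sum. *)
Lemma ones_near_slope (F : nat -> int) s alpha :
  0 < alpha < 1 ->
  (forall n k, `|(F (n + k)%N - F n)%:~R - k%:R * alpha| < 1) ->
  (forall n, s n = if F n.+1 - F n == 0 then false else true) ->
  forall n k,
    `|(count id [seq s (n + j)%N | j <- iota 0 k])%:R - k%:R * alpha| < 1.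
Proof.
move=> /andP[a0 a1] nearF sE n k.
suff -> : (count id [seq s (n + j)%N | j <- iota 0 k])%:R
          = (F (n + k)%N - F n)%:~R :> R by apply: nearF.
elim: k => [|k IHk]; first by rewrite addn0 subrr.
rewrite -addn1 iotaD map_cat count_cat natrD IHk add0n /= addn0.
have -> : F (n + (k + 1))%N - F n
          = (F (n + k)%N - F n) + (F (n + k).+1 - F (n + k)%N).
  by rewrite addn1 addnS [RHS]addrC addrA subrK.
rewrite [RHS]intrD sE; congr (_ + _).
have := nearF (n + k)%N 1%N; rewrite addn1 mul1r.
move: (F _.+1 - _) => D; rewrite ltr_norml => /andP[lo hi].
have D0 : 0 <= D.
  by rewrite -ltzD1 -(ltr_int R) intrD; lra.
have D2 : D < 2 by rewrite -(ltr_int R); lra.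
by case: D D0 D2 {lo hi} => [[|[|D]]|D].
Qed.

Lemma sturmian_balanced s : sturmian R s ->
  forall n m k, (count id [seq s (n + j)%N | j <- iota 0 k] <=
                 (count id [seq s (m + j)%N | j <- iota 0 k]).+1)%N.
Proof.
move=> [alpha [rho [a01 _ sE]]].
suff near n k :
  `|(count id [seq s (n + j)%N | j <- iota 0 k])%:R - k%:R * alpha| < 1.
  move=> n m k; rewrite -ltnS -(ltr_nat R) -addn2 natrD.
  by have := near n k; have := near m k; rewrite !ltr_norml; lra.
case: sE => sE; apply: ones_near_slope a01 _ sE n k => i j.
  have := floor_itv (i%:R * alpha + rho).
  have := floor_itv ((i + j)%:R * alpha + rho).
  by rewrite ltr_norml intrB !intrD natrD; lra.
have := ceil_itv (i%:R * alpha + rho).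
have := ceil_itv ((i + j)%:R * alpha + rho).
by rewrite ltr_norml !intrB natrD; lra.
Qed.

Lemma word28_not_christoffel : ~ christoffel R word28.
Proof.
move=> [_ [s [/sturmian_balanced bal [i wE]]]].
have win p : (p + 5 <= 28)%N ->
    [seq s (i + p + j)%N | j <- iota 0 5] = take 5 (drop p word28).
  move=> le_p; rewrite wE -map_drop -map_take drop_iota take_iota add0n.
  rewrite (minn_idPl _); last first.
    by rewrite leq_subRL // (leq_trans _ le_p) ?leq_addr.
  rewrite -[p in RHS]addn0 iotaDl -map_comp.
  by apply: eq_map => j /=; rewrite addnA.
(* babab occurs at position 13, aabaa at position 0. *)
by have := bal (i + 13)%N (i + 0)%N 5; rewrite !win.
Qed.

End Balance.

(** * The word of length 28 *)

Lemma word28_lyndon : lyndon word28.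
Proof. by apply/lyndonE; vm_compute. Qed.

Lemma num_lyndon_factors_word28 : num_lyndon_factors word28 = 10.
Proof. by rewrite num_lyndon_factorsE; vm_compute. Qed.

Lemma search28 :
  all (fun m => no_extension m 9 27 [:: 0] [seq [:: i] | i <- iota 0 m])
      (iota 1 9).
Proof. by vm_compute. Qed.

Lemma ten_lyndon_factors (d : Order.disp_t) (T : finOrderType d) (u : seq T) :
  lyndon u -> size u = 28 -> 10 <= num_lyndon_factors u.
Proof.
move=> /lyndonE ulyn szu; rewrite num_lyndon_factorsE.
have [p [m [szp p_m plyn]]] := rank_letters u; apply: leq_trans.
apply: (lyndon_list_lower_bound (n := 27) isT search28 _ p_m).
  by rewrite szp.
by rewrite plyn.
Qed.

(* In the refuted assertion w ranges over words over {a < b}, the alphabet for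
   which Christoffel words are defined, while minimality is required among
   Lyndon words over every finite totally ordered alphabet. *)
Theorem mainTheorem6 (R : realType) :
  [/\ lyndon word28 /\ size word28 = 28,
      num_lyndon_factors word28 = 10,
      (forall (d : Order.disp_t) (T : finOrderType d) (u : seq T),
         lyndon u -> size u = 28 -> 10 <= num_lyndon_factors u),
      ~ christoffel R word28 &
      ~ (forall (n : nat) (w : seq bool),
           n <> 6 -> lyndon w -> size w = n ->
           (forall (d : Order.disp_t) (T : finOrderType d) (u : seq T),
              lyndon u -> size u = n ->
              num_lyndon_factors w <= num_lyndon_factors u) ->
           christoffel R w)].
Proof.
have not_chr := @word28_not_christoffel R.
split=> //.
- by split; first exact: word28_lyndon.
- exact: num_lyndon_factors_word28.
- exact: ten_lyndon_factors.
move=> assertion; apply: not_chr.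
apply: (assertion 28) word28_lyndon _ _ => // d T u ulyn szu.
by rewrite num_lyndon_factors_word28 ten_lyndon_factors.
Qed.
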